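(* Let $A$ and $C$ be complex $m\times m$ matrices. The solution $B(t)$ of $$\dot B(t)=(A+e^tC)\,B(t),\qquad B(0)=\mathrm{Id},$$ is given by $$B(t)=\sum_{k\ge 0}\,[\exp(tD)]_{(1,k+1)},$$ where $D=-\sqrt{-1}\,\frac{d}{d\theta}+A+e^{-\sqrt{-1}\,\theta}C$.
   Context: Let $L^2_+(S^1,\mathbb{C}^m)$ be the Hilbert space of $L^2$ $\mathbb{C}^m$-valued functions on the circle whose Fourier expansions contain only $e^{\sqrt{-1}n\theta}$ with $n\ge0$. The first order operator $D$ acts on this space (after composing with the projection $L^2\to L^2_+$, which kills the $e^{-\sqrt{-1}\theta}$ term). With respect to the basis formed by $e^{\sqrt{-1}n\theta}$ ($n\ge 0$) times the standard basis vectors of $\mathbb{C}^m$, $D$ is identified with the infinite block upper-triangular matrix, with $m\times m$ blocks, $$D=\begin{pmatrix}A&C&&&\\&A+1&C&&\\&&A+2&C&\\&&&\ddots&\ddots\end{pmatrix},$$ where $A+n$ means $A+n\,\mathrm{Id}$ and all other blocks are $0$. Block rows and columns are numbered $1,2,3,\ldots$, and $[\,\cdot\,]_{(1,k+1)}$ denotes the $m\times m$ block in block row $1$ and block column $k+1$. The exponential is computed from this matrix: $[\exp(tD)]_{(1,k+1)}=\sum_{j\ge0}\frac{t^j}{j!}[D^j]_{(1,k+1)}$, where the blocks of $D^j$ are finite sums because $D$ is block upper bidiagonal. *)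

(* Defs.v *)
From HB Require Import structures.
From mathcomp Require Import all_boot all_order all_algebra.
From mathcomp Require Import all_classical all_reals all_analysis.
From mathcomp.real_closed Require Import complex.

Set Implicit Arguments.
Unset Strict Implicit.
Unset Printing Implicit Defensive.

Import Order.TTheory GRing.Theory Num.Theory.
Import numFieldNormedType.Exports.

Local Open Scope classical_set_scope.
Local Open Scope ring_scope.
Local Open Scope complex_scope.

(* [R[i]] carries the topology of its modulus; ['M[R[i]]_(m, n)] then inherits
   the library's topology of entrywise convergence. *)
HB.instance Definition _ (R : realType) := NormedModule.copy R[i] R[i]^o.

Section ComplexValued.
Variable R : realType.

Definition expi (x : R) : R[i] := cos x +i* sin x.

(* The library's [derive] needs source and target over the same scalar field,
   so derivatives of complex-valued functions of a real variable are written as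
   limits of difference quotients. *)
Definition dquot m n (f : R -> 'M[R[i]]_(m, n)) (t h : R) : 'M[R[i]]_(m, n) :=
  (h^-1)%:C *: (f (t + h) - f t).

Definition has_cderive m n (f : R -> 'M[R[i]]_(m, n)) (t : R)
    (l : 'M[R[i]]_(m, n)) : Prop :=
  dquot f t h @[h --> 0^'] --> l.

Definition cderive m n (f : R -> 'M[R[i]]_(m, n)) (t : R) : 'M[R[i]]_(m, n) :=
  lim (dquot f t h @[h --> 0^']).

Definition cintegral (a b : R) (f : R -> R[i]) : R[i] :=
  (\int[lebesgue_measure]_(x in `[a, b]) complex.Re (f x)) +i*
  (\int[lebesgue_measure]_(x in `[a, b]) complex.Im (f x)).

(* Functions on the circle are functions of the angle [x]. *)
Definition fourier_coef m (f : R -> 'cV[R[i]]_m) (n : nat) : 'cV[R[i]]_m :=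
  \col_i (((2 * pi)^-1)%:C *
          cintegral 0 (2 * pi) (fun x => expi (- (n%:R * x)) * f x i 0)).

Definition fourier_basis m (n : nat) (j : 'I_m) : R -> 'cV[R[i]]_m :=
  fun x => expi (n%:R * x) *: delta_mx j 0.

Definition opD m (A C : 'M[R[i]]_m) (f : R -> 'cV[R[i]]_m) : R -> 'cV[R[i]]_m :=
  fun x => - 'i *: cderive f x + A *m f x + expi (- x) *: (C *m f x).

(* Infinite block matrices; block rows and columns are numbered from 0, so the
   block usually written [(p + 1, q + 1)] is [X p q]. *)
Definition blockmx m := nat -> nat -> 'M[R[i]]_m.

(* Matrix in the basis [fourier_basis n j], n >= 0, of the operator [T] followed
   by the projection onto nonnegative frequencies: the projection amounts to
   reading off only the coefficients of index [p >= 0]. *)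
Definition op_blockmx m (T : (R -> 'cV[R[i]]_m) -> (R -> 'cV[R[i]]_m)) :
    blockmx m :=
  fun p q => \matrix_(i, j) fourier_coef (T (fourier_basis q j)) p i 0.

Definition block1 m : blockmx m := fun p q => if p == q then 1%:M else 0.

(* Product of infinite block matrices when [Y] is block upper triangular, so
   that [Y r q] vanishes for [r > q] and the sum over all [r] is finite.  This
   covers the powers of [op_blockmx (opD A C)], which is upper bidiagonal:
   [A + q] in position [(q, q)], [C] in position [(q, q.+1)], 0 elsewhere. *)
Definition blockmul m (X Y : blockmx m) : blockmx m :=
  fun p q => \sum_(r < q.+1) X p r *m Y r q.

Definition blockpow m (X : blockmx m) (j : nat) : blockmx m :=
  iter j (fun Y => blockmul Y X) (@block1 m).

Definition blockexp_term m (X : blockmx m) (t : R) (p q j : nat) :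
    'M[R[i]]_m :=
  (t ^+ j / j`!%:R)%:C *: blockpow X j p q.

Definition blockexp m (X : blockmx m) (t : R) : blockmx m :=
  fun p q => limn (series (blockexp_term X t p q)).

Definition solves_ivp m (A C : 'M[R[i]]_m) (B : R -> 'M[R[i]]_m) : Prop :=
  B 0 = 1%:M /\
  forall t : R, has_cderive B t ((A + (expR t)%:C *: C) *m B t).

End ComplexValued.

(* Main.v *)
(* In the Fourier basis D has the blocks A + q in position (q, q) and C in
   position (q, q + 1), so that, writing E_k for the block (1, k + 1) of
   exp(tD), D^(j+1) = D^j D gives E_k' = E_k (A + k) + E_(k-1) C.  The defects
   W_k = E_k' - A E_k - e^t C E_(k-1) then satisfy W_k' = W_k (A + k) once
   W_(k-1) = 0, and W_k(0) = 0; hence they all vanish, and summing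
   E_k' = A E_k + e^t C E_(k-1) over k gives B' = (A + e^t C) B.  All series are
   dominated by their scalar analogues, whose sums are explicit: for scalars
   a, c >= 0 in place of A, C the block is e^(at) (c (e^t - 1))^k / k!. *)
Require Import Defs.
From mathcomp Require Import all_boot all_order all_algebra.
From mathcomp Require Import all_classical all_reals all_analysis.
From mathcomp.real_closed Require Import complex.
From mathcomp Require Import ring lra.

Import Order.TTheory GRing.Theory Num.Theory.
Import numFieldNormedType.Exports.

Local Open Scope classical_set_scope.
Local Open Scope ring_scope.
Local Open Scope complex_scope.

(** The detour through the defects has two reasons. The recursion for the first block row multiplies
    by [A + k] on the right, whereas the differential equation has its coefficients on the left, and
    [A] and [C] need not commute. Moreover, summing the right-hand form over [k] leaves a sum of
    [k E_k], which is not an expression in [B]; in the left-hand form the factor [k] is gone and the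
    sum closes up. The analytic obstacle is that [D] is unbounded: its diagonal blocks [A + k] grow
    with [k], so no estimate by powers of a norm of [D] is available. What survives is that the
    norms of the blocks of [D^j] satisfy the scalar form of the same recursion as an inequality. The
    explicit scalar solution then controls both the series in [j] inside one block and the series in
    [k] over the blocks, uniformly for bounded [t], as termwise differentiation requires. *)

Section ComplexLimits.
Context {R : realType} {T : Type} {F : set_system T} {FF : Filter F}.

Lemma cvg_Re (f : T -> R[i]) (l : R[i]) :
  f @ F --> l -> complex.Re (f x) @[x --> F] --> complex.Re l.
Proof.
move=> /cvgrPdist_lt fl; apply/cvgrPdist_lt => e e0.
have e0' : 0 < e%:C by rewrite ltcR.
apply: filterS (fl _ e0') => x; rewrite -ltcR; apply: le_lt_trans.
by rewrite -raddfB; exact: normc_ge_Re.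
Qed.

Lemma cvg_real_complex (f : T -> R) (l : R) :
  f @ F --> l -> (f x)%:C @[x --> F] --> l%:C.
Proof.
move=> /cvgrPdist_lt fl; apply/cvgrPdist_lt => e e0.
(* The radius of a ball in [R[i]] is itself a complex number; being positive, it is real. *)
have eE : e = (complex.Re e)%:C by rewrite RRe_real// gtr0_real.
have e0' : 0 < complex.Re e by rewrite -ltcR -eE.
apply: filterS (fl _ e0') => x; rewrite eE -raddfB normc_def/= expr0n/= addr0.
by rewrite sqrtr_sqr ltcR.
Qed.

Lemma cvg_Im (f : T -> R[i]) (l : R[i]) :
  f @ F --> l -> complex.Im (f x) @[x --> F] --> complex.Im l.
Proof.
move=> fl; have -> : complex.Im l = complex.Re (- ('i * l)).
  by case: l {fl} => a b /=; ring.
have -> : (fun x => complex.Im (f x)) = (fun x => complex.Re (- ('i * f x))).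
  by apply/funext => x; case: (f x) => a b /=; ring.
by apply: cvg_Re; apply: cvgN; apply: cvgMl_tmp.
Qed.

Lemma cvg_complexP (f : T -> R[i]) (l : R[i]) :
  f @ F --> l <-> complex.Re (f x) @[x --> F] --> complex.Re l /\
                  complex.Im (f x) @[x --> F] --> complex.Im l.
Proof.
split=> [fl|[fr fi]]; first by split; [exact: cvg_Re|exact: cvg_Im].
rewrite [l]complexE (_ : f = fun x => (complex.Re (f x))%:C +
    'i * (complex.Im (f x))%:C); last by apply/funext => x; exact: complexE.
by apply: cvgD; [|apply: cvgMl_tmp]; exact: cvg_real_complex.
Qed.

Lemma cvg_sumr {K : numFieldType} {V : normedModType K} (I : Type) (r : seq I)
    (f : I -> T -> V) (l : I -> V) :
  (forall i, f i x @[x --> F] --> l i) ->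
  \sum_(i <- r) f i x @[x --> F] --> \sum_(i <- r) l i.
Proof.
move=> fl; elim: r => [|i r IHr].
  by rewrite big_nil; under eq_cvg do rewrite big_nil; exact: cvg_cst.
by rewrite big_cons; under eq_cvg do rewrite big_cons; exact: cvgD.
Qed.

Lemma cvg_mxP {K : numFieldType} m n (f : T -> 'M[K]_(m, n)) (l : 'M[K]_(m, n)) :
  f @ F --> l <-> forall i j, f x i j @[x --> F] --> l i j.
Proof.
split=> [fl i j|fl].
  exact: (cvg_comp (fun x => f x) (fun M : 'M[K]_(m, n) => M i j) fl
    (@coord_continuous K m n i j l)).
(* Expansion in matrix units reduces matrix convergence to a finite sum of scalar limits. *)
rewrite [l]matrix_sum_delta (_ : f = fun x => \sum_i \sum_j f x i j *: delta_mx i j);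
  last by apply/funext => x; exact: matrix_sum_delta.
apply: cvg_sumr => i.
apply: cvg_sumr => j.
apply: cvgZr_tmp; exact: fl.
Qed.

Lemma cvg_mulmx {K : numFieldType} m n p (f : T -> 'M[K]_(m, n))
    (g : T -> 'M[K]_(n, p)) (l : 'M[K]_(m, n)) (l' : 'M[K]_(n, p)) :
  f @ F --> l -> g @ F --> l' -> f x *m g x @[x --> F] --> l *m l'.
Proof.
move=> /cvg_mxP fl /cvg_mxP gl; apply/cvg_mxP => i j.
rewrite mxE; under eq_cvg do rewrite mxE.
apply: cvg_sumr => k.
by apply: cvgM; [exact: fl|exact: gl].
Qed.

End ComplexLimits.

(** * Derivatives of complex matrix functions of a real variable *)

Section ComplexDerivative.
Context {R : realType}.

Lemma is_derive_dquotP (u : R -> R) (t v : R) : is_derive t 1 u v <->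
  h^-1 * (u (t + h) - u t) @[h --> 0^'] --> v.
Proof.
have E : (fun h => h^-1 * (u (t + h) - u t)) =
    (fun h => h^-1 *: ((u \o shift t) (h *: 1) - u t)).
  by apply/funext => h /=; rewrite /GRing.scale/= mulr1 [h + t]addrC.
split=> [[du <-]|uv]; first by rewrite E; exact: du.
rewrite E in uv; apply: DeriveDef; first by apply/cvg_ex; exists v.
exact: cvg_lim.
Qed.

Lemma cderive_val m n (f : R -> 'M[R[i]]_(m, n)) (t : R) l :
  has_cderive f t l -> cderive f t = l.
Proof. by move=> fl; apply: cvg_lim. Qed.

(** The factor [h^-1] of the difference quotient is real, so it commutes with taking real and
    imaginary parts. This hands every later derivative over to real one-variable calculus. *)
Lemma has_cderive_mxP m n (f : R -> 'M[R[i]]_(m, n)) (t : R) l :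
  has_cderive f t l <-> forall i j,
    is_derive t 1 (fun s => complex.Re (f s i j)) (complex.Re (l i j)) /\
    is_derive t 1 (fun s => complex.Im (f s i j)) (complex.Im (l i j)).
Proof.
have ReE h i j : complex.Re (dquot f t h i j) =
    h^-1 * (complex.Re (f (t + h) i j) - complex.Re (f t i j)).
  by rewrite !mxE; case: (f _ i j) (f _ i j) => [a b] [c d] /=; ring.
have ImE h i j : complex.Im (dquot f t h i j) =
    h^-1 * (complex.Im (f (t + h) i j) - complex.Im (f t i j)).
  by rewrite !mxE; case: (f _ i j) (f _ i j) => [a b] [c d] /=; ring.
split=> [/cvg_mxP fl i j|fl].
  have /cvg_complexP[fr fi] := fl i j; split; apply/is_derive_dquotP.
    by apply: cvg_trans fr; apply: near_eq_cvg; near=> h; rewrite ReE.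
  by apply: cvg_trans fi; apply: near_eq_cvg; near=> h; rewrite ImE.
apply/cvg_mxP => i j; apply/cvg_complexP; have [fr fi] := fl i j; split.
  by under eq_cvg do rewrite ReE; exact/is_derive_dquotP.
by under eq_cvg do rewrite ImE; exact/is_derive_dquotP.
Unshelve. all: by end_near. Qed.

Lemma has_cderive_cst m n (l : 'M[R[i]]_(m, n)) t : has_cderive (fun=> l) t 0.
Proof.
apply/has_cderive_mxP => i j; rewrite mxE.
by split; exact: is_derive_cst.
Qed.

Lemma has_cderiveD m n (f g : R -> 'M[R[i]]_(m, n)) t df dg :
  has_cderive f t df -> has_cderive g t dg ->
  has_cderive (fun s => f s + g s) t (df + dg).
Proof.
move=> fl gl; rewrite /has_cderive.
have -> : dquot (fun s => f s + g s) t = fun h => dquot f t h + dquot g t h.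
  by apply/funext => h; rewrite /dquot -scalerDr opprD addrACA.
apply: cvgD; [exact: fl|exact: gl].
Qed.

Lemma has_cderiveB m n (f g : R -> 'M[R[i]]_(m, n)) t df dg :
  has_cderive f t df -> has_cderive g t dg ->
  has_cderive (fun s => f s - g s) t (df - dg).
Proof.
move=> fl gl; rewrite /has_cderive.
have -> : dquot (fun s => f s - g s) t = fun h => dquot f t h - dquot g t h.
  apply/funext => h; rewrite /dquot -scalerBr; congr (_ *: _).
  by rewrite !opprB [LHS]addrACA [RHS]addrACA; congr (_ + _); exact: addrC.
apply: cvgB; [exact: fl|exact: gl].
Qed.

Lemma has_cderive_mulmxl m n p (A : 'M[R[i]]_(m, n)) (f : R -> 'M[R[i]]_(n, p))
    t df : has_cderive f t df -> has_cderive (fun s => A *m f s) t (A *m df).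
Proof.
move=> fl; rewrite /has_cderive.
have -> : dquot (fun s => A *m f s) t = fun h => A *m dquot f t h.
  by apply/funext => h; rewrite /dquot -scalemxAr mulmxBr.
by apply: cvg_mulmx; [exact: cvg_cst|exact: fl].
Qed.

Lemma has_cderive_mulmxr m n p (A : 'M[R[i]]_(n, p)) (f : R -> 'M[R[i]]_(m, n))
    t df : has_cderive f t df -> has_cderive (fun s => f s *m A) t (df *m A).
Proof.
move=> fl; rewrite /has_cderive.
have -> : dquot (fun s => f s *m A) t = fun h => dquot f t h *m A.
  by apply/funext => h; rewrite /dquot -scalemxAl mulmxBl.
by apply: cvg_mulmx; [exact: fl|exact: cvg_cst].
Qed.

Lemma has_cderiveZ m n (u : R -> R) (f : R -> 'M[R[i]]_(m, n))
    (t du : R) df :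
  is_derive t 1 u du -> has_cderive f t df ->
  has_cderive (fun s => (u s)%:C *: f s) t (du%:C *: f t + (u t)%:C *: df).
Proof.
move=> ud /has_cderive_mxP fd; apply/has_cderive_mxP => i j.
have [fr fi] := fd i j.
split.
  rewrite (_ : (fun s => _) = u * (fun s => complex.Re (f s i j))).
    apply: is_derive_eq; rewrite !mxE; case: (f t i j) (df i j) => [a b] [c d] /=.
    by rewrite /GRing.scale/=; ring.
  apply/funext => s; rewrite mxE -[RHS]/(u s * complex.Re (f s i j)).
  by case: (f s i j) => a b /=; ring.
rewrite (_ : (fun s => _) = u * (fun s => complex.Im (f s i j))).
  apply: is_derive_eq; rewrite !mxE; case: (f t i j) (df i j) => [a b] [c d] /=.
  by rewrite /GRing.scale/=; ring.
apply/funext => s; rewrite mxE -[RHS]/(u s * complex.Im (f s i j)).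
by case: (f s i j) => a b /=; ring.
Qed.

End ComplexDerivative.

(** * Dominated real series, termwise differentiation, and vanishing of solutions of linear
    equations *)

Section RealSeries.
Context {R : realType}.

Lemma series_dominated (u M : R^nat) : (forall n, `|u n| <= M n) ->
  cvgn (series M) -> cvgn (series u).
Proof.
move=> uM cM; apply: normed_cvg.
apply: series_le_cvg cM => n; [exact: normr_ge0| |exact: uM].
exact: le_trans (normr_ge0 _) (uM n).
Qed.

(** Limit of the comparison of partial sums between [N] and [P]. The bound depends on [M] alone, so
    one [N] serves every series dominated by [M]. *)
Lemma series_dominated_tail (u M : R^nat) N : (forall n, `|u n| <= M n) ->
  cvgn (series M) ->
  `|limn (series u) - series u N| <= limn (series M) - series M N.
Proof.
move=> uM cM; have cu := series_dominated _ _ uM cM.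
have c : `|series u P - series u N| @[P --> \oo] -->
    `|limn (series u) - series u N|.
  by apply: cvg_norm; apply: cvgB => //; exact: cvg_cst.
rewrite -(cvg_lim _ c)//; apply: limr_le; first by apply/cvg_ex; eexists; exact: c.
near=> P; have NP : (N <= P)%N by near: P; exact: nbhs_infty_ge.
rewrite sub_series_geq//; apply: le_trans (ler_norm_sum _ _ _) _.
apply: (@le_trans _ _ (series M P - series M N)).
  by rewrite sub_series_geq//; apply: ler_sum => k _.
rewrite lerD2r; apply: nondecreasing_cvgn_le => //.
apply/nondecreasing_seqP => n; rewrite /series/= big_nat_recr//= lerDl.
exact: le_trans (normr_ge0 _) (uM n).
Unshelve. all: by end_near. Qed.

Lemma is_derive_sumr (I : Type) (r : seq I) (f g : I -> R -> R) (t : R) :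
  (forall i, is_derive t 1 (f i) (g i t)) ->
  is_derive t 1 (fun s => \sum_(i <- r) f i s) (\sum_(i <- r) g i t).
Proof.
move=> fg; elim: r => [|i r IH].
  rewrite [X in is_derive _ _ X](_ : _ = cst 0); last first.
    by apply/funext => s; rewrite big_nil.
  by rewrite big_nil; exact: is_derive_cst.
rewrite [X in is_derive _ _ X](_ : _ = f i + (fun s => \sum_(j <- r) f j s)).
  by rewrite big_cons; exact: is_deriveD.
by apply/funext => s; rewrite big_cons.
Qed.

Lemma derive_dominated_lipschitz (f g : R -> R) (M T s t : R) :
  (forall x : R, is_derive x 1 f (g x)) ->
  (forall x, `|x| <= T -> `|g x| <= M) ->
  `|s| <= T -> `|t| <= T -> `|f s - f t| <= M * `|s - t|.
Proof.
move=> fg gM; wlog st : s t / t <= s => [H sT tT|].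
  have [st|/ltW st] := leP t s; first exact: H.
  by rewrite distrC [`|s - t|]distrC; exact: H.
move=> sT tT.
have cf : {within `[t, s], continuous f}.
  by apply: derivable_within_continuous => x _; have [] := fg x.
have [x] := @MVT_segment R f g t s st (fun x _ => fg x) cf.
rewrite in_itv/= => /andP[tx xs] ->; rewrite normrM ler_wpM2r//; apply: gM.
move: sT tT; rewrite !ler_norml => /andP[_ sT] /andP[Tt _].
by rewrite (le_trans Tt tx) (le_trans xs sT).
Qed.

(** By the mean value theorem [M n] bounds the difference quotients of [f n] as well as its
    derivative. The two tails are therefore at most [e / 3] each beyond a common [N], independently
    of [h], and the remaining [e / 3] pays for the finite sum of the first [N] terms. *)
Lemma is_derive_series_dominated (f g : nat -> R -> R) (M : R^nat) (T t : R) :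
  (forall n (s : R), is_derive s 1 (f n) (g n s)) ->
  (forall n s, `|s| <= T -> `|g n s| <= M n) ->
  cvgn (series M) -> (forall s, cvgn (series (f^~ s))) -> `|t| < T ->
  is_derive t 1 (fun s => limn (series (f^~ s))) (limn (series (g^~ t))).
Proof.
move=> fg gM cM cf tT; apply/is_derive_dquotP/cvgrPdist_le => e e0.
have e30 : 0 < e / 3 by rewrite divr_gt0.
have [N NM] : exists N, limn (series M) - series M N <= e / 3.
  have /cvgrPdist_le/(_ _ e30)[N _ NM] := cM.
  by exists N; apply: le_trans (NM N _); [exact: ler_norm|rewrite /=].
have /is_derive_dquotP/cvgrPdist_le/(_ _ e30) S :=
  is_derive_sumr _ (index_iota 0 N) f g t (fg^~ t).
near=> h.
have h0 : h != 0 by near: h; exact: nbhs_dnbhs_neq.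
(* Here the strict inequality between the modulus of [t] and [T] is spent: it leaves room for
   [h]. *)
have thT : `|t + h| <= T.
  rewrite (le_trans (ler_normD _ _))// -lerBrDl; apply: ltW.
  near: h; apply: dnbhs0_lt; by rewrite subr_gt0.
pose u n := h^-1 * (f n (t + h) - f n t).
have uM n : `|u n| <= M n.
  rewrite /u normrM normfV ler_pdivrMl ?normr_gt0// mulrC.
  apply: le_trans (derive_dominated_lipschitz _ _ _ _ _ _ (fg n) (gM n) thT (ltW tT)) _.
  by rewrite addrAC subrr add0r.
have su P : series u P = h^-1 * (series (f^~ (t + h)) P - series (f^~ t) P).
  by rewrite /series/= -sumrB mulr_sumr.
have lu : limn (series u) =
    h^-1 * (limn (series (f^~ (t + h))) - limn (series (f^~ t))).
  apply: cvg_lim => //; rewrite (_ : series u = fun P => h^-1 *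
    (series (f^~ (t + h)) P - series (f^~ t) P)); last exact/funext.
  by apply: cvgMl_tmp; apply: cvgB; exact: cf.
have tu := le_trans (series_dominated_tail u M N uM cM) NM.
have tg := le_trans (series_dominated_tail (g^~ t) M N (fun n => gM n t (ltW tT)) cM) NM.
have th : `|series (g^~ t) N - series u N| <= e / 3.
  by rewrite su; near: h.
rewrite -lu; move: tu tg th.
move: (limn _) (series u N) (limn (series (g^~ t))) (series _ N) => a b c d.
rewrite !ler_norml => /andP[? ?] /andP[? ?] /andP[? ?].
by apply/andP; split; lra.
Unshelve. all: by end_near. Qed.

(** Cauchy-Schwarz against the constant family 1, obtained by expanding the square and bounding each
    product by the mean of the two squares. *)
Lemma sqr_sum_le (I : finType) (a : I -> R) :
  (\sum_i `|a i|) ^+ 2 <= #|I|%:R * \sum_i a i ^+ 2.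
Proof.
rewrite expr2 mulr_suml.
under eq_bigr do rewrite mulr_sumr.
apply: (@le_trans _ _ (\sum_i \sum_j (a i ^+ 2 / 2 + a j ^+ 2 / 2))).
  apply: ler_sum => i _; apply: ler_sum => j _.
  rewrite -(real_normK (num_real (a i))) -(real_normK (num_real (a j))).
  rewrite -subr_ge0.
  rewrite (_ : _ - _ = (`|a i| - `|a j|) ^+ 2 / 2); last by field.
  by rewrite divr_ge0// sqr_ge0.
under eq_bigr do rewrite big_split/= sumr_const.
by rewrite big_split/= sumr_const sumrMnl -mulrnDl -mulr_suml -splitr mulr_natl.
Qed.

(* Gronwall, applied to [\sum_i u_i ^+ 2]. *)
Lemma linear_ode_zero (I : finType) (u du : I -> R -> R) (K T : R) :
  (forall i (s : R), is_derive s 1 (u i) (du i s)) ->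
  (forall i s, `|s| <= T -> `|du i s| <= K * \sum_j `|u j s|) ->
  (forall i, u i 0 = 0) -> 0 <= K ->
  forall i t, `|t| <= T -> u i t = 0.
Proof.
move=> udu duK u0 K0 i t tT.
pose y s := \sum_j u j s ^+ 2; pose dy s := \sum_j 2 * u j s * du j s.
have yge0 s : 0 <= y s by apply: sumr_ge0 => j _; exact: sqr_ge0.
have y0 : y 0 = 0 by rewrite /y big1// => j _; rewrite u0 expr0n.
have ydy (s : R) : is_derive s 1 y (dy s).
  apply: (is_derive_sumr _ _ (fun j s => u j s ^+ 2) (fun j s => 2 * u j s * du j s)) => j.
  have := udu j s => uj.
  rewrite [X in is_derive _ _ X](_ : _ = u j ^+ 2); last by apply/funext.
  by apply: is_derive_eq; rewrite expr1 /GRing.scale/=.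
(* The derivative of [y] is at most [2 K] times the square of the sum of the absolute values of the
   [u j]; [sqr_sum_le] turns that square into [#|I|] times [y]. *)
pose L := 2 * K * #|I|%:R.
have dyL s : `|s| <= T -> `|dy s| <= L * y s.
  move=> sT; apply: le_trans (ler_norm_sum _ _ _) _.
  apply: (@le_trans _ _ (2 * K * (\sum_j `|u j s|) ^+ 2)).
    rewrite [leRHS](_ : _ = \sum_j 2 * `|u j s| * (K * \sum_k `|u k s|)); last first.
      by rewrite -mulr_suml -mulr_sumr; ring.
    apply: ler_sum => j _.
    by rewrite !normrM ger0_norm// ler_wpM2l ?mulr_ge0//; exact: duK.
  by rewrite /L -[leRHS]mulrA ler_wpM2l ?mulr_ge0//; exact: sqr_sum_le.
suff yt : y t <= 0.
  have /eqP : y t = 0 by apply/eqP; rewrite eq_le yt yge0.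
  rewrite psumr_eq0; last by move=> j _; exact: sqr_ge0.
  by move=> /allP/(_ i (mem_index_enum i)); rewrite sqrf_eq0 => /eqP.
have zd (c s : R) : is_derive s 1 (fun s => y s * expR (c * s))
    ((dy s + c * y s) * expR (c * s)).
  have e : is_derive s 1 (fun s => expR (c * s)) (expR (c * s) * c).
    apply: (@is_derive1_comp _ expR ( *%R c)).
    rewrite [X in is_derive _ _ X](_ : _ = c \*: id)//.
    by apply: is_derive_eq; rewrite /GRing.scale/= mulr1.
  rewrite [X in is_derive _ _ X](_ : _ = y * (fun s => expR (c * s)))//.
  by apply: is_derive_eq; rewrite /GRing.scale/=; ring.
have zc c : continuous (fun s => y s * expR (c * s)).
  move=> s; apply: differentiable_continuous; apply/derivable1_diffP.
  by have [] := zd c s.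
(* The integrating factor depends on the direction of time: [y] times [expR (- L * s)] cannot
   increase to the right of 0, and [y] times [expR (L * s)] cannot decrease to the left of 0. Both
   products vanish at 0. *)
have [t0|/ltW t0] := leP 0 t.
- have : y t * expR (- L * t) <= y 0 * expR (- L * 0).
    apply: (@ler0_derive1_nincr R (fun s => y s * expR (- L * s)) 0 t) => //.
    + move=> x /[!in_itv]/= /andP[x0 xt]; have [_] := zd (- L) x.
      rewrite derive1E => ->; rewrite pmulr_lle0 ?expR_gt0// mulNr subr_le0.
      apply: le_trans (ler_norm _) (dyL _ _).
      by rewrite ger0_norm ?(ltW x0)// (le_trans (ltW xt))// (le_trans (ler_norm t)).
    + exact: continuous_subspaceT.
  by rewrite y0 mul0r pmulr_lle0 ?expR_gt0.
- have : y t * expR (L * t) <= y 0 * expR (L * 0).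
    apply: (@ger0_derive1_ndecr R (fun s => y s * expR (L * s)) t 0) => //.
    + move=> x /[!in_itv]/= /andP[tx x0]; have [_] := zd L x.
      rewrite derive1E => ->; rewrite pmulr_lge0 ?expR_gt0// -lerBlDr sub0r.
      rewrite lerNl; apply: le_trans (_ : `|dy x| <= _); first by rewrite -normrN ler_norm.
      apply: dyL; rewrite ltr0_norm// (le_trans _ tT)// ler0_norm// lerN2; exact: ltW.
    + exact: continuous_subspaceT.
  by rewrite y0 mul0r pmulr_lle0 ?expR_gt0.
Qed.

End RealSeries.

(** * Real components and an entrywise norm for complex matrices *)

Section Parts.
Context {R : realType}.

(** The boolean index makes a complex matrix one finite family of real numbers, indexed by
    [bool * ('I_m * 'I_n)], which is the shape that [linear_ode_zero] accepts. *)
Definition part (b : bool) (z : R[i]) : R := if b then complex.Im z else complex.Re z.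

Lemma part_sum b (I : Type) (r : seq I) (F : I -> R[i]) :
  part b (\sum_(i <- r) F i) = \sum_(i <- r) part b (F i).
Proof. by case: b; rewrite /part raddf_sum. Qed.

Lemma part_inj (z w : R[i]) : (forall b, part b z = part b w) -> z = w.
Proof. by case: z w => [a b] [c d] E; move: (E false) (E true) => /= -> ->. Qed.

Lemma part_series b m n (f : nat -> 'M[R[i]]_(m, n)) N i j :
  part b (series f N i j) = series (fun k => part b (f k i j)) N.
Proof. by rewrite /series/= summxE part_sum. Qed.

Lemma cvg_partP {T : Type} {F : set_system T} {FF : Filter F} m n
    (f : T -> 'M[R[i]]_(m, n)) (l : 'M[R[i]]_(m, n)) :
  f @ F --> l <->
  forall b i j, part b (f x i j) @[x --> F] --> part b (l i j).
Proof.
split=> [/cvg_mxP fl b i j|fl].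
  by have /cvg_complexP[fr fi] := fl i j; case: b.
apply/cvg_mxP => i j; apply/cvg_complexP.
by split; [exact: fl false i j|exact: fl true i j].
Qed.

Lemma has_cderive_partP m n (f : R -> 'M[R[i]]_(m, n)) (t : R) l :
  has_cderive f t l <-> forall b i j,
    is_derive t 1 (fun s => part b (f s i j)) (part b (l i j)).
Proof.
split=> [/has_cderive_mxP fl b i j|fl].
  by have [fr fi] := fl i j; case: b.
apply/has_cderive_mxP => i j.
by split; [exact: fl false i j|exact: fl true i j].
Qed.

Lemma part_lim_series b m n (f : nat -> 'M[R[i]]_(m, n)) i j :
  cvgn (series f) ->
  cvgn (series (fun k => part b (f k i j))) /\
  part b (limn (series f) i j) = limn (series (fun k => part b (f k i j))).
Proof.
move=> /cvg_partP/(_ b i j); under eq_cvg do rewrite part_series.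
by move=> c; split; [apply/cvg_ex; eexists; exact: c|exact/esym/cvg_lim].
Qed.

(** Unlike the modulus on [R[i]], this norm takes values in [R]. It is submultiplicative, and its
    sum over the entries is exactly the sum of absolute values in [linear_ode_zero]. *)
Definition cnorm1 (z : R[i]) : R := `|complex.Re z| + `|complex.Im z|.

Definition mxnorm1 {m n} (M : 'M[R[i]]_(m, n)) : R := \sum_i \sum_j cnorm1 (M i j).

Lemma cnorm1_ge0 z : 0 <= cnorm1 z. Proof. by rewrite addr_ge0. Qed.

Lemma cnorm1D z w : cnorm1 (z + w) <= cnorm1 z + cnorm1 w.
Proof.
by rewrite /cnorm1 !raddfD addrACA lerD//; exact: ler_normD.
Qed.

Lemma cnorm1_sum (I : Type) (r : seq I) (F : I -> R[i]) :
  cnorm1 (\sum_(i <- r) F i) <= \sum_(i <- r) cnorm1 (F i).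
Proof.
elim: r => [|i r IH]; first by rewrite !big_nil /cnorm1 normr0 addr0.
by rewrite !big_cons (le_trans (cnorm1D _ _))// lerD2l.
Qed.

Lemma cnorm1M z w : cnorm1 (z * w) <= cnorm1 z * cnorm1 w.
Proof.
case: z w => [a b] [c d]; rewrite /cnorm1/= mulrDl !mulrDr -!normrM.
rewrite (le_trans (lerD (ler_normB _ _) (ler_normD _ _)))// le_eqVlt.
by apply/orP; left; apply/eqP; ring.
Qed.

Lemma mxnorm1_ge0 m n (M : 'M[R[i]]_(m, n)) : 0 <= mxnorm1 M.
Proof. by apply: sumr_ge0 => i _; apply: sumr_ge0 => j _; exact: cnorm1_ge0. Qed.

Lemma mxnorm10 m n : mxnorm1 (0 : 'M[R[i]]_(m, n)) = 0.
Proof.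
by rewrite /mxnorm1 big1// => i _; rewrite big1// => j _; rewrite mxE /cnorm1 normr0 addr0.
Qed.

Lemma mxnorm1D m n (M N : 'M[R[i]]_(m, n)) :
  mxnorm1 (M + N) <= mxnorm1 M + mxnorm1 N.
Proof.
rewrite -big_split; apply: ler_sum => i _; rewrite -big_split.
by apply: ler_sum => j _; rewrite mxE cnorm1D.
Qed.

Lemma mxnorm1_sum m n (I : Type) (r : seq I) (F : I -> 'M[R[i]]_(m, n)) :
  mxnorm1 (\sum_(i <- r) F i) <= \sum_(i <- r) mxnorm1 (F i).
Proof.
elim: r => [|i r IH]; first by rewrite !big_nil mxnorm10.
by rewrite !big_cons (le_trans (mxnorm1D _ _ _ _))// lerD2l.
Qed.

Lemma mxnorm1Z m n (x : R) (M : 'M[R[i]]_(m, n)) :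
  mxnorm1 (x%:C *: M) = `|x| * mxnorm1 M.
Proof.
rewrite mulr_sumr; apply: eq_bigr => i _; rewrite mulr_sumr.
apply: eq_bigr => j _; rewrite mxE /cnorm1; case: (M i j) => a b /=.
by rewrite mul0r subr0 mul0r addr0 mulrDr -!normrM.
Qed.

Lemma cnorm1_le_mxnorm1 m n (M : 'M[R[i]]_(m, n)) i j : cnorm1 (M i j) <= mxnorm1 M.
Proof.
rewrite /mxnorm1 (bigD1 i)//= (bigD1 j)//= -addrA lerDl addr_ge0//.
  by apply: sumr_ge0 => k _; exact: cnorm1_ge0.
by apply: sumr_ge0 => k _; apply: sumr_ge0 => l _; exact: cnorm1_ge0.
Qed.

Lemma part_le_mxnorm1 b m n (M : 'M[R[i]]_(m, n)) i j :
  `|part b (M i j)| <= mxnorm1 M.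
Proof.
apply: le_trans (cnorm1_le_mxnorm1 _ _ M i j).
by case: b; rewrite /cnorm1/= ?lerDl ?lerDr.
Qed.

Lemma mxnorm1M m n p (M : 'M[R[i]]_(m, n)) (N : 'M[R[i]]_(n, p)) :
  mxnorm1 (M *m N) <= mxnorm1 M * mxnorm1 N.
Proof.
apply: (@le_trans _ _ (\sum_i \sum_j \sum_k cnorm1 (M i k) * cnorm1 (N k j))).
  apply: ler_sum => i _; apply: ler_sum => j _; rewrite mxE.
  by rewrite (le_trans (cnorm1_sum _ _ _))//; apply: ler_sum => k _; exact: cnorm1M.
rewrite mulr_suml; apply: ler_sum => i _; rewrite exchange_big mulr_suml.
apply: ler_sum => k _; rewrite -mulr_sumr ler_wpM2l ?cnorm1_ge0//.
rewrite /mxnorm1 (bigD1 k)//= lerDl.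
by apply: sumr_ge0 => l _; apply: sumr_ge0 => j _; exact: cnorm1_ge0.
Qed.

Lemma mxnorm1E m n (M : 'M[R[i]]_(m, n)) :
  mxnorm1 M = \sum_(p : bool * ('I_m * 'I_n)) `|part p.1 (M p.2.1 p.2.2)|.
Proof.
rewrite -(pair_bigA _ (fun b p => `|part b (M p.1 p.2)|)) big_bool/= -big_split.
by rewrite /mxnorm1 pair_bigA; apply: eq_bigr => p _; rewrite /cnorm1 addrC.
Qed.

Lemma cvg_mxnorm1 {T : Type} {F : set_system T} {FF : Filter F} m n
    (f : T -> 'M[R[i]]_(m, n)) (l : 'M[R[i]]_(m, n)) :
  f @ F --> l -> mxnorm1 (f x) @[x --> F] --> mxnorm1 l.
Proof.
move=> /cvg_partP fl; rewrite mxnorm1E; under eq_cvg do rewrite mxnorm1E.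
by apply: cvg_sumr => p; apply: cvg_norm; exact: fl.
Qed.

Lemma mx_series_dominated m n (f : nat -> 'M[R[i]]_(m, n)) (M : R^nat) :
  (forall k, mxnorm1 (f k) <= M k) -> cvgn (series M) -> cvgn (series f).
Proof.
move=> fM cM.
pose l : 'M[R[i]]_(m, n) := \matrix_(i, j)
  (limn (series (fun k => part false (f k i j))) +i*
   limn (series (fun k => part true (f k i j)))).
apply/cvg_ex; exists l; apply/cvg_partP => b i j.
under eq_cvg do rewrite part_series.
have -> : part b (l i j) = limn (series (fun k => part b (f k i j))).
  by rewrite mxE; case: b.
apply: series_dominated cM => k; exact: le_trans (part_le_mxnorm1 _ _ _ _ _ _) (fM k).
Qed.

Lemma mx_series_dominated_norm m n (f : nat -> 'M[R[i]]_(m, n)) (M : R^nat) :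
  (forall k, mxnorm1 (f k) <= M k) -> cvgn (series M) ->
  mxnorm1 (limn (series f)) <= limn (series M).
Proof.
move=> fM cM.
have c : mxnorm1 (series f N) @[N --> \oo] --> mxnorm1 (limn (series f)).
  by apply: cvg_mxnorm1; exact: mx_series_dominated fM cM.
rewrite -(cvg_lim _ c)//; apply: limr_le; first by apply/cvg_ex; eexists; exact: c.
near=> N; apply: le_trans (mxnorm1_sum _ _ _ _ _) _.
apply: (@le_trans _ _ (series M N)); first exact: ler_sum.
apply: nondecreasing_cvgn_le => //.
apply/nondecreasing_seqP => k; rewrite /series/= big_nat_recr//= lerDl.
exact: le_trans (mxnorm1_ge0 _ _ _) (fM k).
Unshelve. all: by end_near. Qed.

Lemma has_cderive_series m n (f g : nat -> R -> 'M[R[i]]_(m, n)) (M : R^nat) (T t : R) :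
  (forall k s, has_cderive (f k) s (g k s)) ->
  (forall k s, `|s| <= T -> mxnorm1 (g k s) <= M k) ->
  cvgn (series M) -> (forall s, cvgn (series (f^~ s))) -> `|t| < T ->
  has_cderive (fun s => limn (series (f^~ s))) t (limn (series (g^~ t))).
Proof.
move=> fg gM cM cf tT; apply/has_cderive_partP => b i j.
have cg : cvgn (series (g^~ t)).
  by apply: mx_series_dominated cM => k; exact/gM/ltW.
rewrite (part_lim_series b _ _ _ i j cg).2.
rewrite [X in is_derive _ _ X](_ : _ =
    fun s => limn (series (fun k => part b (f k s i j)))); last first.
  by apply/funext => s; rewrite (part_lim_series b _ _ _ i j (cf s)).2.
apply: (is_derive_series_dominated (fun k s => part b (f k s i j))
  (fun k s => part b (g k s i j)) M T) => //.
- by move=> k s; have /has_cderive_partP := fg k s; exact.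
- by move=> k s sT; apply: le_trans (part_le_mxnorm1 _ _ _ _ _ _) (gM k s sT).
- by move=> s; have [] := part_lim_series b _ _ _ i j (cf s).
Qed.

(** The uniqueness principle behind both the vanishing of the defects and the uniqueness of [B].
    Each real component of [df] is at most [mxnorm1 (df s)], and [mxnorm1 (f s)] is the sum of all
    components in absolute value. *)
Lemma mx_linear_ode_zero m n (f df : R -> 'M[R[i]]_(m, n)) (K T t : R) :
  (forall s, has_cderive f s (df s)) ->
  (forall s, `|s| <= T -> mxnorm1 (df s) <= K * mxnorm1 (f s)) ->
  f 0 = 0 -> 0 <= K -> `|t| <= T -> f t = 0.
Proof.
move=> fdf dfK f0 K0 tT; apply/matrixP => i j; apply: part_inj => b.
rewrite [in RHS]mxE [RHS](_ : _ = 0); last by case: b.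
apply: (@linear_ode_zero _ (bool * ('I_m * 'I_n))%type
  (fun p s => part p.1 (f s p.2.1 p.2.2))
  (fun p s => part p.1 (df s p.2.1 p.2.2)) K T _ _ _ K0 (b, (i, j)) t tT).
- by move=> p s; have /has_cderive_partP := fdf s; exact.
- by move=> p s sT; rewrite -mxnorm1E (le_trans (part_le_mxnorm1 _ _ _ _ _ _))// dfK.
- by move=> p; rewrite f0 mxE; case: p.1.
Qed.

End Parts.

(** * The matrix of [D] in the Fourier basis *)

Section Fourier.
Context {R : realType}.

Lemma Rintegral_derive (F f : R -> R) (a b : R) : a < b ->
  (forall x : R, is_derive x 1 F (f x)) -> continuous f ->
  \int[lebesgue_measure]_(x in `[a, b]) f x = F b - F a.
Proof.
move=> ab Ff cf; have cF : continuous F.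
  move=> x; apply: differentiable_continuous; apply/derivable1_diffP.
  by have [] := Ff x.
rewrite /Rintegral (@continuous_FTC2 R f F a b)//.
- exact: continuous_subspaceT.
- split=> [x _||]; first by have [] := Ff x.
    exact/cvg_at_right_filter/cF.
  exact/cvg_at_left_filter/cF.
- by move=> x _; rewrite derive1E; have [_ ->] := Ff x.
Qed.

Lemma expiD (x y : R) : expi (x + y) = expi x * expi y.
Proof.
by rewrite /expi sinD cosD; apply/eqP; rewrite eq_complex/= eqxx [_ + sin x * _]addrC eqxx.
Qed.

Lemma is_derive_sinM (z x : R) : is_derive x 1 (fun s => sin (z * s)) (z * cos (z * x)).
Proof.
rewrite mulrC; apply: (@is_derive1_comp _ sin ( *%R z)).
rewrite [X in is_derive _ _ X](_ : _ = z \*: id)//.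
by apply: is_derive_eq; rewrite /GRing.scale/= mulr1.
Qed.

Lemma is_derive_cosM (z x : R) : is_derive x 1 (fun s => cos (z * s)) (- (z * sin (z * x))).
Proof.
rewrite mulrC -mulNr; apply: (@is_derive1_comp _ cos ( *%R z)).
rewrite [X in is_derive _ _ X](_ : _ = z \*: id)//.
by apply: is_derive_eq; rewrite /GRing.scale/= mulr1.
Qed.

(** [cosI] and [sinI] are antiderivatives in [x] of [cos (z * x)] and [sin (z * x)]. Frequency 0,
    where the usual formula would divide by zero, is the one that survives integration over the
    circle. *)
Definition cosI (z x : R) : R := if z == 0 then x else z^-1 * sin (z * x).
Definition sinI (z x : R) : R := if z == 0 then 0 else - z^-1 * cos (z * x).

Lemma is_derive_cosI (z x : R) : is_derive x 1 (cosI z) (cos (z * x)).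
Proof.
rewrite /cosI; have [->|z0] := eqVneq z 0.
  by rewrite mul0r cos0; exact: is_derive_id.
have d := is_derive_sinM z x.
rewrite [X in is_derive _ _ X](_ : _ = z^-1 \*: (fun s => sin (z * s)))//.
by apply: is_derive_eq; rewrite /GRing.scale/= mulKf.
Qed.

Lemma is_derive_sinI (z x : R) : is_derive x 1 (sinI z) (sin (z * x)).
Proof.
rewrite /sinI; have [->|z0] := eqVneq z 0.
  by rewrite mul0r sin0; exact: is_derive_cst.
have d := is_derive_cosM z x.
rewrite [X in is_derive _ _ X](_ : _ = (- z^-1) \*: (fun s => cos (z * s)))//.
by apply: is_derive_eq; rewrite /GRing.scale/= mulrNN mulKf.
Qed.

Lemma sin_int2pi (n : int) : sin (n%:~R * (2 * pi)) = 0 :> R.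
Proof.
have E k : k%:R * (2 * pi) = 0 + (pi *+ 2) *+ k :> R.
  by rewrite add0r mulr_natl mulr_natl.
case: n => k; rewrite ?NegzE ?rmorphN/= ?mulNr ?sinN E.
  by rewrite (periodicn (@sinD2pi R)) sin0.
by rewrite (periodicn (@sinD2pi R)) sin0 oppr0.
Qed.

Lemma cos_int2pi (n : int) : cos (n%:~R * (2 * pi)) = 1 :> R.
Proof.
have E k : k%:R * (2 * pi) = 0 + (pi *+ 2) *+ k :> R.
  by rewrite add0r mulr_natl mulr_natl.
by case: n => k; rewrite ?NegzE ?rmorphN/= ?mulNr ?cosN E (periodicn (@cosD2pi R)) cos0.
Qed.

Lemma cosI_2pi (n : int) :
  cosI n%:~R (2 * pi) - cosI n%:~R 0 = (2 * pi) * (n == 0)%:R :> R.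
Proof.
rewrite /cosI intr_eq0; case: eqVneq => _; first by rewrite subr0 mulr1.
by rewrite sin_int2pi !mulr0 sin0 !mulr0 subrr.
Qed.

Lemma sinI_2pi (n : int) : sinI n%:~R (2 * pi) - sinI n%:~R 0 = 0 :> R.
Proof.
rewrite /sinI intr_eq0; case: eqVneq => _; first by rewrite subr0.
by rewrite cos_int2pi !mulr0 cos0 subrr.
Qed.

(** Orthogonality of the exponentials: over a full period the antiderivatives return to their
    starting value unless the frequency is 0. Two frequencies are treated together because [D] sends
    a basis vector to exactly such a sum. *)
Lemma cintegral_expi (n k : int) (a c : R[i]) :
  cintegral 0 (2 * pi)
    (fun x => expi (n%:~R * x) * a + expi (k%:~R * x) * c) =
  (2 * pi)%:C * ((n == 0)%:R * a + (k == 0)%:R * c).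
Proof.
have pi20 : 0 < 2 * pi :> R by rewrite mulr_gt0// pi_gt0.
have csin (z : R) : continuous (fun x => sin (z * x)).
  move=> x; apply: differentiable_continuous; apply/derivable1_diffP.
  by have [] := is_derive_sinM z x.
have ccos (z : R) : continuous (fun x => cos (z * x)).
  move=> x; apply: differentiable_continuous; apply/derivable1_diffP.
  by have [] := is_derive_cosM z x.
have int4 (z w a1 a2 a3 a4 : R) :
    \int[lebesgue_measure]_(x in `[0, 2 * pi])
      (a1 * cos (z * x) + a2 * sin (z * x) + a3 * cos (w * x) + a4 * sin (w * x)) =
    a1 * (cosI z (2 * pi) - cosI z 0) + a2 * (sinI z (2 * pi) - sinI z 0) +
    a3 * (cosI w (2 * pi) - cosI w 0) + a4 * (sinI w (2 * pi) - sinI w 0).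
  have dF (x : R) : is_derive x 1 (fun x => a1 * cosI z x + a2 * sinI z x +
      a3 * cosI w x + a4 * sinI w x) (a1 * cos (z * x) + a2 * sin (z * x) +
      a3 * cos (w * x) + a4 * sin (w * x)).
    have d1 := is_derive_cosI z x; have d2 := is_derive_sinI z x.
    have d3 := is_derive_cosI w x; have d4 := is_derive_sinI w x.
    rewrite [X in is_derive _ _ X](_ : _ = a1 \*: cosI z + a2 \*: sinI z +
      a3 \*: cosI w + a4 \*: sinI w)//.
    exact: is_derive_eq.
  rewrite (Rintegral_derive _ _ _ _ pi20 dF); first by ring.
  by move=> x; do ?apply: cvgD; apply: cvgMl_tmp; first [exact: ccos|exact: csin].
case: a c => [a1 a2] [c1 c2].
apply/eqP; rewrite eq_complex; apply/andP; split; apply/eqP.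
  transitivity (\int[lebesgue_measure]_(x in `[0, 2 * pi])
      (a1 * cos (n%:~R * x) + - a2 * sin (n%:~R * x) +
       c1 * cos (k%:~R * x) + - c2 * sin (k%:~R * x))).
    by apply: (congr1 (Rintegral lebesgue_measure `[0, 2 * pi])); apply/funext => x /=; ring.
  by rewrite int4 !cosI_2pi !sinI_2pi; case: eqVneq => _; case: eqVneq => _ /=; ring.
transitivity (\int[lebesgue_measure]_(x in `[0, 2 * pi])
    (a2 * cos (n%:~R * x) + a1 * sin (n%:~R * x) +
     c2 * cos (k%:~R * x) + c1 * sin (k%:~R * x))).
  by apply: (congr1 (Rintegral lebesgue_measure `[0, 2 * pi])); apply/funext => x /=; ring.
by rewrite int4 !cosI_2pi !sinI_2pi; case: eqVneq => _; case: eqVneq => _ /=; ring.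
Qed.

Lemma has_cderive_fourier_basis m (n : nat) (j : 'I_m) (x : R) :
  has_cderive (fourier_basis n j) x (('i * n%:R * expi (n%:R * x)) *: delta_mx j 0).
Proof.
apply/has_cderive_mxP => i l; rewrite !mxE; set b := (_ && _).
have d1 := is_derive_cosM n%:R x; have d2 := is_derive_sinM n%:R x.
have nE : n%:R = (n%:R)%:C :> R[i] by rewrite rmorph_nat.
have bE : (nat_of_bool b)%:R = (b%:R)%:C :> R[i] by rewrite rmorph_nat.
split.
  rewrite [X in is_derive _ _ X](_ : _ = b%:R \*: (fun s => cos (n%:R * s))).
    apply: is_derive_eq; rewrite /GRing.scale nE bE /=; ring.
  by apply/funext => s; rewrite !mxE -/b bE /= /GRing.scale/=; ring.
rewrite [X in is_derive _ _ X](_ : _ = b%:R \*: (fun s => sin (n%:R * s))).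
  apply: is_derive_eq; rewrite /GRing.scale nE bE /=; ring.
by apply/funext => s; rewrite !mxE -/b bE /= /GRing.scale/=; ring.
Qed.

(** Differentiation brings down ['i * q], which [- 'i] turns into [q]; the factor [expi (- x)] in
    front of [C] lowers the frequency by one. *)
Lemma opD_fourier_basis m (A C : 'M[R[i]]_m) (q : nat) (j : 'I_m) x i :
  opD A C (fourier_basis q j) x i 0 =
  expi (q%:R * x) * (A i j + (q%:R%:M : 'M[R[i]]_m) i j) + expi (q%:R * x - x) * C i j.
Proof.
rewrite /opD (cderive_val _ _ _ _ _ (has_cderive_fourier_basis m q j x)).
rewrite /fourier_basis -!scalemxAr -!colE !scalerA.
have -> : - 'i * ('i * q%:R * expi (q%:R * x)) = q%:R * expi (q%:R * x).
  by rewrite !mulrA mulNr -expr2 sqrCi opprK mul1r.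
rewrite [_ * x - x]addrC expiD !mxE andbT -[q%:R *+ _]mulr_natr. ring.
Qed.

(** The coefficient of index [p] tests the frequencies [q - p] and [q - (p + 1)] for being 0. These
    are integers, so for [q = 0] the second is negative and never counts: this is the projection
    killing the term of frequency -1. *)
Lemma op_blockmx_opD m (A C : 'M[R[i]]_m) (p q : nat) :
  op_blockmx (opD A C) p q =
  (p == q)%:R *: (A + q%:R%:M) + (p.+1 == q)%:R *: C.
Proof.
apply/matrixP => i j; rewrite !mxE.
rewrite (_ : (fun x => _) = fun x =>
    expi ((q%:Z - p%:Z)%:~R * x) * (A i j + (q%:R%:M : 'M[R[i]]_m) i j) +
    expi ((q%:Z - p.+1%:Z)%:~R * x) * C i j).
  rewrite cintegral_expi mulrA -rmorphM mulVf ?mul1r; last first.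
    by rewrite mulf_neq0// gt_eqF// pi_gt0.
  by rewrite !subr_eq0 !eqz_nat !(eq_sym q) !mxE.
apply/funext => x; rewrite opD_fourier_basis mulrDr !mulrA -!expiD !rmorphB/=.
by congr (expi _ * _ + expi _ * _); rewrite ?natrS; ring.
Qed.

End Fourier.

(** * Index shift by one *)

Section Delay.
Context {K : numFieldType} {V : normedModType K}.

(** The convention that the term of index -1 is 0, which lets the recursions be stated without a
    case distinction. It serves both the block index [k] and the power index [j], the latter because
    [s ^+ j / j!] has the preceding term as derivative. *)
Definition delay (u : nat -> V) (k : nat) : V := if k is k'.+1 then u k' else 0.

Lemma series_delay (u : nat -> V) N : series (delay u) N.+1 = series u N.
Proof. by rewrite /series/= big_nat_recl//= add0r. Qed.

Lemma cvg_series_delay (u : nat -> V) (l : V) :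
  series u @ \oo --> l -> series (delay u) @ \oo --> l.
Proof.
move=> ul; rewrite -cvg_shiftS.
by under eq_fun do rewrite series_delay.
Qed.

End Delay.

(** * The scalar comparison system *)

Section Majorant.
Context {R : realType}.

Definition expterm (s : R) (j : nat) : R := s ^+ j / j`!%:R.

Lemma expterm_ge0 s j : 0 <= s -> 0 <= expterm s j.
Proof. by move=> s0; rewrite divr_ge0// exprn_ge0. Qed.

Lemma is_derive_expterm (s : R) j :
  is_derive s 1 (expterm^~ j) (delay (expterm s) j).
Proof.
rewrite [X in is_derive _ _ X](_ : _ = (j`!%:R)^-1 \*: (id ^+ j)); last first.
  by apply/funext => x; rewrite /expterm mulrC !fctE.
apply: is_derive_eq; rewrite /GRing.scale/= mulr1; case: j => [|j] /=.
  by rewrite mul0r mulr0.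
rewrite /expterm factS natrM; field.
by rewrite nat1r !pnatr_eq0 -lt0n fact_gt0.
Qed.

Context (a c e0 : R) (p : nat -> nat -> R).
Hypotheses (a_ge0 : 0 <= a) (c_ge0 : 0 <= c) (e0_ge0 : 0 <= e0)
  (p0 : forall k, p 0%N k <= (k == 0%N)%:R * e0)
  (pS : forall j k, p j.+1 k <= (a + k%:R) * p j k + c * delay (p j) k).

(** Coefficient of [z^k] in [e0 * expR (a * s) * expR (c * z * (expR s - 1))], the generating
    function solving [G_s = a G + z G_z + c z G] with value [e0] at [s = 0]. The factor [e0] is kept
    because it will be the entrywise norm of the identity, which is [m] and not 1. *)
Definition majorant (k : nat) (s : R) : R :=
  e0 * expR (a * s) * expterm (c * (expR s - 1)) k.

Lemma majorant_ge0 k s : 0 <= s -> 0 <= majorant k s.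
Proof.
move=> s0; apply: mulr_ge0; first by rewrite mulr_ge0// expR_ge0.
apply: expterm_ge0.
by rewrite mulr_ge0// subr_ge0 -expR0 ler_expR.
Qed.

Lemma is_derive_majorant k (s : R) :
  is_derive s 1 (majorant k)
    ((a + k%:R) * majorant k s + c * delay (majorant^~ s) k).
Proof.
have d1 : is_derive s 1 (fun s => expR (a * s)) (expR (a * s) * a).
  apply: (@is_derive1_comp _ expR ( *%R a)).
  rewrite [X in is_derive _ _ X](_ : _ = a \*: id)//.
  by apply: is_derive_eq; rewrite /GRing.scale/= mulr1.
have d2 : is_derive s 1 (fun s => c * (expR s - 1)) (c * expR s).
  rewrite [X in is_derive _ _ X](_ : _ = c \*: (expR - cst 1))//.
  by apply: is_derive_eq; rewrite subr0.
have d3 := @is_derive1_comp _ (expterm^~ k) _ s _ _ (is_derive_expterm _ k) d2.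
rewrite [X in is_derive _ _ X](_ : _ = e0 \*: ((fun s => expR (a * s)) *
  ((expterm^~ k) \o (fun s => c * (expR s - 1)))))//; last first.
  by apply/funext => x; rewrite /majorant -mulrA.
apply: is_derive_eq; rewrite /GRing.scale/= /majorant.
case: k {d3} => [|k] /=; first by ring.
(* Writing [c * expR s] as [c * (expR s - 1) + c] splits the derivative of the power: the first
   summand gives [k] times the majorant of index [k], the second [c] times the preceding one. *)
rewrite /expterm exprS factS natrM; field.
by rewrite nat1r !pnatr_eq0 -lt0n fact_gt0.
Qed.

(* Comparing derivatives, by induction on [N], bounds the partial sums before any
   convergence is known. *)
Lemma partial_sum_le_majorant N k s : 0 <= s ->
  series (fun j => expterm s j * p j k) N <= majorant k s.
Proof.
elim: N k s => [|N IH] k s s0.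
  by rewrite /series/= big_geq//; exact: majorant_ge0.
(* Differentiation drops the term [j = 0] and shifts the others, so [N + 1] terms become [N] terms
   in [p j.+1]. After [pS], the induction hypothesis applies at [k] and at [k - 1]. *)
pose f x := series (fun j => expterm x j * p j k) N.+1.
pose df x := series (fun j => expterm x j * p j.+1 k) N.
have fdf (x : R) : is_derive x 1 f (df x).
  have -> : df x = \sum_(0 <= j < N.+1) delay (expterm x) j * p j k.
    by rewrite big_nat_recl//= mul0r add0r.
  apply: (is_derive_sumr _ _ (fun j x => expterm x j * p j k)
    (fun j x => delay (expterm x) j * p j k)) => j.
  have d := is_derive_expterm x j.
  rewrite [X in is_derive _ _ X](_ : _ = p j k \*: (expterm^~ j)); last first.
    by apply/funext => y; rewrite mulrC.
  by apply: is_derive_eq; rewrite /GRing.scale/= mulrC.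
have dfle x : 0 <= x -> df x <= (a + k%:R) * majorant k x + c * delay (majorant^~ x) k.
  move=> x0; apply: (@le_trans _ _ (\sum_(0 <= j < N) ((a + k%:R) * (expterm x j * p j k) +
      c * (expterm x j * delay (p j) k)))).
    apply: ler_sum => j _; apply: le_trans (ler_wpM2l (expterm_ge0 _ _ x0) (pS j k)) _.
    by rewrite le_eqVlt; apply/orP; left; apply/eqP; ring.
  rewrite big_split/= -!mulr_sumr lerD//.
    by rewrite ler_wpM2l ?addr_ge0//; exact: IH.
  rewrite ler_wpM2l//; case: k {f df fdf} => [|k] /=; last exact: IH.
  by rewrite big1// => j _; rewrite mulr0.
have hd (x : R) : is_derive x 1 (majorant k - f)
    ((a + k%:R) * majorant k x + c * delay (majorant^~ x) k - df x).
  by apply: is_deriveB; exact: is_derive_majorant.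
have hc : continuous (majorant k - f).
  move=> x; apply: differentiable_continuous; apply/derivable1_diffP.
  by have [] := hd x.
rewrite -subr_ge0; apply: (@le_trans _ _ ((majorant k - f) 0)).
  rewrite subr_ge0 /f /series/= big_nat_recl//= big1.
    rewrite addr0 {1}/expterm expr0 fact0 invr1 !mul1r (le_trans (p0 k))//.
    rewrite /majorant mulr0 expR0 subrr mulr0 mulr1 mulrC ler_wpM2l//.
    by case: k {f df fdf dfle hd hc} => [|k];
      rewrite /expterm ?expr0 ?fact0 ?divr1 ?exprS ?mul0r.
  by move=> j _; rewrite /expterm exprS !mul0r.
apply: (@ger0_derive1_ndecr R (majorant k - f) 0 s) => //.
- move=> x /[!in_itv]/= /andP[x0 xs]; have [_] := hd x.
  by rewrite derive1E => ->; rewrite subr_ge0 dfle// ltW.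
- exact: continuous_subspaceT.
Qed.

End Majorant.

(** * The first block row of [exp(tD)], the defects, and the sum over the row *)

Section Solution.
Context {R : realType} {m : nat} (A C : 'M[R[i]]_m).
Local Notation D := (op_blockmx (opD A C)).
Local Notation P j := (blockpow D j 0%N).
Local Notation E k t := (blockexp D t 0%N k).
Local Notation a := (mxnorm1 A).
Local Notation c := (mxnorm1 C).
Local Notation e0 := (mxnorm1 (1%:M : 'M[R[i]]_m)).

(** With the new factor [D] on the right the first block row evolves by itself; on the left it would
    bring in the second row. Column [k] of [D] has nonzero blocks at most in rows [k] and
    [k - 1]. *)
Lemma blockpowS_row0 j k :
  P j.+1 k = P j k *m (A + k%:R%:M) + delay (P j) k *m C.
Proof.
rewrite /= /blockmul; under eq_bigr => r _ do rewrite op_blockmx_opD.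
rewrite big_ord_recr/= eqxx scale1r gtn_eqF// scale0r addr0 addrC; congr (_ + _).
case: k => [|k]; first by rewrite big_ord0 mul0mx.
rewrite big_ord_recr/= eqxx scale1r ltn_eqF// scale0r add0r big1 ?add0r// => r _.
have rk := ltn_ord r.
by rewrite !ltn_eqF ?scale0r ?addr0 ?mulmx0// ltnS ltnW.
Qed.

Lemma mxnorm1_delay (u : nat -> 'M[R[i]]_m) k :
  mxnorm1 (delay u k) = delay (fun k => mxnorm1 (u k)) k.
Proof. by case: k => //=; exact: mxnorm10. Qed.

Lemma mxnorm1_blockpow0 k : mxnorm1 (P 0%N k) <= (k == 0%N)%:R * e0.
Proof. by rewrite /= /block1; case: k => [|k] /=; rewrite ?mul1r ?mul0r ?mxnorm10. Qed.

Lemma mxnorm1_blockpowS j k :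
  mxnorm1 (P j.+1 k) <= (a + k%:R) * mxnorm1 (P j k) +
    c * delay (fun k => mxnorm1 (P j k)) k.
Proof.
rewrite blockpowS_row0 -mxnorm1_delay; apply: le_trans (mxnorm1D _ _ _ _) _.
apply: lerD; last by rewrite mulrC; exact: mxnorm1M.
rewrite mulmxDr mul_mx_scalar mulrDl; apply: le_trans (mxnorm1D _ _ _ _) _.
apply: lerD; first by rewrite mulrC; exact: mxnorm1M.
have -> : k%:R = (k%:R)%:C :> R[i] by rewrite rmorph_nat.
by rewrite mxnorm1Z ger0_norm.
Qed.

Local Notation H := (majorant a c e0).

Lemma mxnorm1_blockpow_series N k (s : R) : 0 <= s ->
  series (fun j => expterm s j * mxnorm1 (P j k)) N <= H k s.
Proof.
apply: (partial_sum_le_majorant a c e0 (fun j k => mxnorm1 (P j k))).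
- exact: mxnorm1_ge0.
- exact: mxnorm1_ge0.
- exact: mxnorm1_ge0.
- exact: mxnorm1_blockpow0.
- exact: mxnorm1_blockpowS.
Qed.

Lemma cvg_mxnorm1_blockpow_series k (s : R) : 0 <= s ->
  cvgn (series (fun j => expterm s j * mxnorm1 (P j k))).
Proof.
move=> s0; apply: nondecreasing_is_cvgn.
  apply/nondecreasing_seqP => n; rewrite /series/= big_nat_recr//= lerDl.
  by rewrite mulr_ge0 ?expterm_ge0 ?mxnorm1_ge0.
by exists (H k s) => _ [N _ <-]; exact: mxnorm1_blockpow_series.
Qed.

Lemma expterm_le (s T : R) j : `|s| <= T -> `|expterm s j| <= expterm T j.
Proof.
move=> sT; rewrite /expterm normrM normfV [`|j`!%:R|]ger0_norm// ler_wpM2r ?invr_ge0//.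
by rewrite normrX lerXn2r// nnegrE// (le_trans _ sT).
Qed.

Lemma mxnorm1_blockexp_term (s T : R) k j : `|s| <= T ->
  mxnorm1 (blockexp_term D s 0 k j) <= expterm T j * mxnorm1 (P j k).
Proof.
by move=> sT; rewrite mxnorm1Z ler_wpM2r ?mxnorm1_ge0//; exact: expterm_le.
Qed.

Lemma cvg_blockexp_term (s : R) k : cvgn (series (blockexp_term D s 0 k)).
Proof.
apply: mx_series_dominated (cvg_mxnorm1_blockpow_series k `|s| (normr_ge0 s)) => j.
exact: mxnorm1_blockexp_term.
Qed.

(** The comparison with the majorant holds only for nonnegative times. Evaluating it at [T] covers
    negative [s] as well and gives the uniform bound needed for the series in [k]. *)
Lemma mxnorm1_blockexp (s T : R) k : `|s| <= T -> mxnorm1 (E k s) <= H k T.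
Proof.
move=> sT; have T0 := le_trans (normr_ge0 s) sT.
have cT := cvg_mxnorm1_blockpow_series k T T0.
apply: le_trans (mx_series_dominated_norm _ _ _ _ _ cT) _.
  by move=> j; exact: mxnorm1_blockexp_term.
by apply: limr_le => //; near=> N; exact: mxnorm1_blockpow_series.
Unshelve. all: by end_near. Qed.

Lemma blockexp0 k : E k 0 = P 0%N k.
Proof.
apply: cvg_lim => //; rewrite -cvg_shiftS.
rewrite (_ : (fun n => _) = cst (P 0%N k)); first exact: cvg_cst.
apply/funext => N; rewrite /series/= big_nat_recl// big1.
  by rewrite addr0 /blockexp_term expr0 fact0 divr1 scale1r.
by move=> j _; rewrite /blockexp_term exprS !mul0r scale0r.
Qed.

Lemma has_cderive_blockexp k (s : R) :
  has_cderive (fun s => E k s) s (E k s *m (A + k%:R%:M) + delay (blockexp D s 0) k *m C).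
Proof.
pose g j s := (delay (expterm s) j)%:C *: P j k.
pose T := `|s| + 1; have T0 : 0 <= T by rewrite addr_ge0.
(* The differentiated series starts with a zero term, hence the offset between [N.+1] and [N]; then
   [blockpowS_row0] is applied to each remaining term. *)
have gS N x : series (g^~ x) N.+1 = series (blockexp_term D x 0 k) N *m (A + k%:R%:M) +
    delay (fun k => series (blockexp_term D x 0 k) N) k *m C.
  have g0 : g 0%N x = 0 by rewrite /g scale0r.
  rewrite /series [LHS]big_nat_recl// g0 add0r mulmx_suml.
  rewrite (_ : delay _ k = \sum_(0 <= j < N) (expterm x j)%:C *: delay (P j) k).
    rewrite mulmx_suml -big_split; apply: eq_bigr => j _.
    by rewrite /g blockpowS_row0 scalerDr -!scalemxAl.
  by case: (k) => [|k']//=; rewrite big1// => j _; rewrite scaler0.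
have -> : E k s *m (A + k%:R%:M) + delay (blockexp D s 0) k *m C = limn (series (g^~ s)).
  apply/esym/cvg_lim => //; rewrite -cvg_shiftS; under eq_fun do rewrite gS.
  apply: cvgD; apply: cvg_mulmx.
  - exact: cvg_blockexp_term.
  - exact: cvg_cst.
  - by case: (k) => [|k'] /=; [exact: cvg_cst|exact: cvg_blockexp_term].
  - exact: cvg_cst.
pose M j := delay (expterm T) j * mxnorm1 (P j k).
have M0 j : 0 <= M j.
  by rewrite mulr_ge0 ?mxnorm1_ge0//; case: j => //= j; exact: expterm_ge0.
have cM : cvgn (series M).
  suff cS : cvgn (fun n => series M n.+1).
    by apply/cvg_ex; exists (limn (fun n => series M n.+1)); rewrite -cvg_shiftS; exact: cS.
  apply: nondecreasing_is_cvgn.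
    apply/nondecreasing_seqP => n; rewrite /series/= [leRHS]big_nat_recr//= lerDl.
    exact: M0.
  (* The bound is the derivative of the majorant at [T], as in [is_derive_majorant]. *)
  exists ((a + k%:R) * H k T + c * delay (H^~ T) k) => _ [N _ <-].
  rewrite /series/= big_nat_recl//= {1}/M/= mul0r add0r.
  apply: (@le_trans _ _ (\sum_(0 <= j < N) ((a + k%:R) * (expterm T j * mxnorm1 (P j k)) +
      c * (expterm T j * delay (fun k => mxnorm1 (P j k)) k)))).
    apply: ler_sum => j _.
    apply: le_trans (ler_wpM2l (expterm_ge0 _ _ T0) (mxnorm1_blockpowS j k)) _.
    by rewrite le_eqVlt; apply/orP; left; apply/eqP; ring.
  rewrite big_split/= -!mulr_sumr lerD//.
    by rewrite ler_wpM2l ?addr_ge0 ?mxnorm1_ge0//; exact: mxnorm1_blockpow_series.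
  rewrite ler_wpM2l ?mxnorm1_ge0//; case: (k) => [|k'] /=; last exact: mxnorm1_blockpow_series.
  by rewrite big1// => j _; rewrite mulr0.
apply: (has_cderive_series _ _ (fun j x => blockexp_term D x 0 k j) g M T).
- move=> j x; have := has_cderiveZ _ _ _ (fun=> P j k) x _ _
    (is_derive_expterm x j) (has_cderive_cst _ _ (P j k) x).
  by rewrite scaler0 addr0.
- move=> j x xT; rewrite mxnorm1Z ler_wpM2r ?mxnorm1_ge0//.
  by case: j => [|j] /=; [rewrite normr0|exact: expterm_le].
- exact: cM.
- by move=> x; exact: cvg_blockexp_term.
- by rewrite /T ltrDl.
Qed.

Lemma has_cderive_delay (f df : nat -> R -> 'M[R[i]]_m) (k : nat) (t : R) :
  (forall k, has_cderive (f k) t (df k t)) ->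
  has_cderive (fun s => delay (f^~ s) k) t (delay (df^~ t) k).
Proof. by move=> fdf; case: k => [|k] /=; [exact: has_cderive_cst|exact: fdf]. Qed.

(** To be read with [K = A + k], [U = E_k], [V = E_(k-1)], [dV = V'] and [e = e^t]: the left side of
    the conclusion is the derivative of the defect. All terms in [U] match; the hypothesis is what
    the others must satisfy. *)
Lemma defect_algebra (K U V dV : 'M[R[i]]_m) (e : R[i]) :
  dV *m C - A *m V *m C =
    e *: (C *m V) + e *: (C *m dV) - e *: (C *m V) *m K ->
  (U *m K + V *m C) *m K + dV *m C -
    (A *m (U *m K + V *m C) + (e *: (C *m V) + e *: (C *m dV))) =
  (U *m K + V *m C - (A *m U + e *: (C *m V))) *m K.
Proof.
have cancel (x y z w v Y : 'M[R[i]]_m) :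
    y - w = Y - v -> x + y - (z + w + Y) = x - (z + v).
  move=> h; rewrite -[y](subrK w) h.
  by apply/matrixP => i j; rewrite !mxE; ring.
move=> h; rewrite mulmxBl mulmxDr [(A *m U + _) *m K]mulmxDl !mulmxA.
exact: cancel.
Qed.

(** Here [K = A + (k - 1)], [V = E_(k-1)] and [Z = E_(k-2)]; the two hypotheses are the right and
    left forms of [V'], which agree once the preceding defect is 0. The term [e *: (C *m V)] coming
    from the derivative of [e^t] cancels against the unit by which [A + k] exceeds [A + (k - 1)];
    both sides reduce to [e *: (C *m Z *m C)]. *)
Lemma delay_algebra (K V Z dV : 'M[R[i]]_m) (e : R[i]) :
  dV = V *m K + Z *m C -> dV = A *m V + e *: (C *m Z) ->
  dV *m C - A *m V *m C =
    e *: (C *m V) + e *: (C *m dV) - e *: (C *m V) *m (K + 1%:M).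
Proof.
have cancel (x y z w : 'M[R[i]]_m) : x + z - x = y + (w + z) - (w + y).
  by apply/matrixP => i j; rewrite !mxE; ring.
move=> h1 h2; rewrite {1}h2 h1 mulmxDl -scalemxAl mulmxDr scalerDr.
rewrite [_ *m (K + _)]mulmxDr mulmx1 -scalemxAl !mulmxA.
exact: cancel.
Qed.

(** The derivative of [E_k] enters through its formula from [has_cderive_blockexp], so that the
    defect can be differentiated once more by the product rules. *)
Definition ode_defect k (t : R) : 'M[R[i]]_m :=
  E k t *m (A + k%:R%:M) + delay (blockexp D t 0) k *m C -
  (A *m E k t + (expR t)%:C *: (C *m delay (blockexp D t 0) k)).

Lemma has_cderive_ode_defect k :
  (forall t, delay (ode_defect^~ t) k = 0) ->
  forall t, has_cderive (ode_defect k) t (ode_defect k t *m (A + k%:R%:M)).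
Proof.
move=> W0 t; pose dE k s := E k s *m (A + k%:R%:M) + delay (blockexp D s 0) k *m C.
have dU := has_cderive_blockexp k t.
have dV : has_cderive (fun s => delay (blockexp D s 0) k) t (delay (dE^~ t) k).
  by apply: has_cderive_delay => l; exact: has_cderive_blockexp.
have dW := has_cderiveB _ _ _ _ _ _ _
  (has_cderiveD _ _ _ _ _ _ _ (has_cderive_mulmxr _ _ _ (A + k%:R%:M) _ _ _ dU)
     (has_cderive_mulmxr _ _ _ C _ _ _ dV))
  (has_cderiveD _ _ _ _ _ _ _ (has_cderive_mulmxl _ _ _ A _ _ _ dU)
     (has_cderiveZ _ _ _ _ _ _ _ (is_derive_expR t) (has_cderive_mulmxl _ _ _ C _ _ _ dV))).
suff <- : (E k t *m (A + k%:R%:M) + delay (blockexp D t 0) k *m C) *m (A + k%:R%:M)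
    + delay (dE^~ t) k *m C
    - (A *m (E k t *m (A + k%:R%:M) + delay (blockexp D t 0) k *m C)
       + ((expR t)%:C *: (C *m delay (blockexp D t 0) k)
          + (expR t)%:C *: (C *m delay (dE^~ t) k)))
  = ode_defect k t *m (A + k%:R%:M) by exact: dW.
set K := A + k%:R%:M; set U := E k t; set V := delay (blockexp D t 0) k.
set dV' := delay _ k; set e := (expR t)%:C.
have h : dV' *m C - A *m V *m C =
    e *: (C *m V) + e *: (C *m dV') - (e *: (C *m V)) *m K.
  move: (W0 t); rewrite /dV' /V /K /ode_defect /dE; case: (k) => [|k'] /=.
    by rewrite !mulmx0 !mul0mx scaler0 mul0mx !subr0 addr0.
  rewrite -/e => /eqP; rewrite subr_eq0 => /eqP Wk.
  have -> : A + k'.+1%:R%:M = A + k'%:R%:M + 1%:M.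
    by rewrite -natr1 raddfD addrA.
  by apply: delay_algebra Wk.
exact: defect_algebra.
Qed.

Lemma ode_defect0 k : ode_defect k 0 = 0.
Proof.
rewrite /ode_defect blockexp0 expR0 scale1r.
have -> : delay (blockexp D 0 0) k = delay (P 0%N) k.
  by case: k => //= k; exact: blockexp0.
rewrite /= /block1; case: k => [|[|k]] /=.
(* At time 0 the defect is [A - A] for [k = 0], [C - C] for [k = 1] since [e^0 = 1], and has only
   zero terms beyond. *)
- by rewrite mul1mx mulmx1 mul0mx mulmx0 !addr0 raddf0 addr0 subrr.
- by rewrite mul0mx mulmx0 !add0r mul1mx mulmx1 subrr.
- by rewrite !mul0mx !mulmx0 !addr0 subrr.
Qed.

Lemma ode_defect_eq0 k t : ode_defect k t = 0.
Proof.
elim: k t => [|k IH] t.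
- apply: (mx_linear_ode_zero _ _ _ _ (mxnorm1 (A + 0%:R%:M)) `|t| t
    (has_cderive_ode_defect 0 (fun=> erefl))) => //; last exact: mxnorm1_ge0.
  + by move=> s _; rewrite mulrC; exact: mxnorm1M.
  + exact: ode_defect0.
- apply: (mx_linear_ode_zero _ _ _ _ (mxnorm1 (A + k.+1%:R%:M)) `|t| t
    (has_cderive_ode_defect k.+1 IH)) => //; last exact: mxnorm1_ge0.
  + by move=> s _; rewrite mulrC; exact: mxnorm1M.
  + exact: ode_defect0.
Qed.

Lemma has_cderive_blockexp_left k t :
  has_cderive (fun s => E k s) t
    (A *m E k t + (expR t)%:C *: (C *m delay (blockexp D t 0) k)).
Proof.
have /eqP := ode_defect_eq0 k t; rewrite subr_eq0 => /eqP <-.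
exact: has_cderive_blockexp.
Qed.

(** Up to a constant factor this is the exponential series at [c * (expR T - 1)]. *)
Lemma cvg_majorant_series (T : R) : cvgn (series (H^~ T)).
Proof.
have ce := is_cvg_series_exp_coeff (c * (expR T - 1)).
have -> : series (H^~ T) = fun N =>
    e0 * expR (a * T) * series (exp_coeff (c * (expR T - 1))) N.
  by apply/funext => N; rewrite /series/= mulr_sumr.
by apply/cvg_ex; eexists; apply: cvgMl_tmp; exact: ce.
Qed.

Lemma cvg_blockexp_series t : cvgn (series (fun k => E k t)).
Proof.
apply: mx_series_dominated (cvg_majorant_series `|t|) => k.
exact: mxnorm1_blockexp.
Qed.

Lemma has_cderive_blockexp_sum t :
  has_cderive (fun s => limn (series (fun k => E k s))) t
    ((A + (expR t)%:C *: C) *m limn (series (fun k => E k t))).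
Proof.
pose g k s := A *m E k s + (expR s)%:C *: (C *m delay (blockexp D s 0) k).
pose T := `|t| + 1; have T0 : 0 <= T by rewrite addr_ge0.
pose M k := a * H k T + expR T * c * delay (H^~ T) k.
have cM : cvgn (series M).
  have cH := cvg_majorant_series T; have cH' := cvg_series_delay _ _ cH.
  apply/cvg_ex; exists (a * limn (series (H^~ T)) + expR T * c * limn (series (H^~ T))).
  have -> : series M = fun N => a * series (H^~ T) N +
      expR T * c * series (delay (H^~ T)) N.
    by apply/funext => N; rewrite /series/= /M big_split/= -!mulr_sumr.
  apply: cvgD; apply: cvgMl_tmp.
    exact: cH.
  exact: cH'.
have -> : (A + (expR t)%:C *: C) *m limn (series (fun k => E k t)) = limn (series (g^~ t)).
  apply/esym/cvg_lim => //.
  have cE := cvg_blockexp_series t; have cE' := cvg_series_delay _ _ cE.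
  rewrite mulmxDl (_ : series (g^~ t) = fun N => A *m series (fun k => E k t) N +
      ((expR t)%:C *: C) *m series (delay (blockexp D t 0)) N).
    apply: cvgD; apply: cvg_mulmx.
    - exact: cvg_cst.
    - exact: cE.
    - exact: cvg_cst.
    - exact: cE'.
  apply/funext => N; rewrite /series/= !mulmx_sumr -big_split.
  by apply: eq_bigr => k _; rewrite /g scalemxAl.
apply: (has_cderive_series _ _ (fun k s => E k s) g M T).
- by move=> k s; exact: has_cderive_blockexp_left.
- move=> k s sT; apply: le_trans (mxnorm1D _ _ _ _) _; apply: lerD.
    apply: le_trans (mxnorm1M _ _ _ _ _) _; rewrite ler_wpM2l ?mxnorm1_ge0//.
    exact: mxnorm1_blockexp.
  rewrite mxnorm1Z ger0_norm ?expR_ge0// -mulrA.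
  apply: ler_pM; rewrite ?expR_ge0 ?mxnorm1_ge0//.
    by rewrite ler_expR (le_trans (ler_norm s)).
  apply: le_trans (mxnorm1M _ _ _ _ _) _; rewrite ler_wpM2l ?mxnorm1_ge0//.
  by rewrite mxnorm1_delay; case: (k) => //= k'; exact: mxnorm1_blockexp.
- exact: cM.
- by move=> s; exact: cvg_blockexp_series.
- by rewrite /T ltrDl.
Qed.

Lemma blockexp_sum0 : limn (series (fun k => E k 0)) = 1%:M.
Proof.
apply: cvg_lim => //; rewrite -cvg_shiftS.
rewrite (_ : (fun n => _) = cst (1%:M : 'M[R[i]]_m)); first exact: cvg_cst.
apply/funext => N; rewrite /series/= big_nat_recl// big1.
  by rewrite addr0 blockexp0.
by move=> k _; rewrite blockexp0.
Qed.

(** The difference solves the same linear equation with initial value 0, and for times of modulus at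
    most that of [t] the coefficient matrix has norm at most [a + expR |t| * c]. *)
Lemma solves_ivp_unique (B B' : R -> 'M[R[i]]_m) :
  solves_ivp A C B -> solves_ivp A C B' -> forall t, B' t = B t.
Proof.
move=> [B0 dB] [B'0 dB'] t; apply/eqP; rewrite -subr_eq0; apply/eqP.
refine (mx_linear_ode_zero _ _ (fun s => B' s - B s)
  (fun s => (A + (expR s)%:C *: C) *m B' s - (A + (expR s)%:C *: C) *m B s)
  (a + expR `|t| * c) `|t| t _ _ _ _ (lexx _)).
- by move=> s; apply: has_cderiveB; [exact: dB'|exact: dB].
- move=> s st; rewrite -mulmxBr; apply: le_trans (mxnorm1M _ _ _ _ _) _.
  rewrite ler_wpM2r ?mxnorm1_ge0//; apply: le_trans (mxnorm1D _ _ _ _) _.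
  rewrite lerD2l mxnorm1Z ger0_norm ?expR_ge0// ler_wpM2r ?mxnorm1_ge0//.
  by rewrite ler_expR (le_trans (ler_norm s)).
- by rewrite B0 B'0 subrr.
- by rewrite addr_ge0 ?mulr_ge0 ?expR_ge0 ?mxnorm1_ge0.
Qed.

End Solution.

Theorem proposition3p1 (R : realType) (m : nat) (A C : 'M[R[i]]_m) :
  let D : blockmx R m := op_blockmx (opD A C) in
  let B : R -> 'M[R[i]]_m :=
    fun t => limn (series (fun k => blockexp D t 0%N k)) in
  [/\ forall (t : R) (k : nat), cvgn (series (blockexp_term D t 0%N k)),
      forall t : R, cvgn (series (fun k => blockexp D t 0%N k)),
      solves_ivp A C B
    & forall B' : R -> 'M[R[i]]_m, solves_ivp A C B' ->
        forall t : R, B' t = B t].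
Proof.
move=> D B.
have sB : solves_ivp A C B.
  by split; [exact: blockexp_sum0|exact: has_cderive_blockexp_sum].
split.
- by move=> t k; exact: cvg_blockexp_term.
- exact: cvg_blockexp_series.
- exact: sB.
- by move=> B' sB' t; exact: (solves_ivp_unique A C B B' sB sB' t).
Qed.
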